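(* Let $p\ge1$ and let $U^p(\Omega)$ be a polynomial $H^1$-conforming subspace (basis) on the unit tetrahedron $\Omega$, split into vertex, edge, face and cell base functions $\mathcal V^p_i,\mathcal E^p_j,\mathcal F^p_k,\mathcal C^p_{1234}$. Consider the polytopal template $$\mathcal T_1=\{-\mathbf e_1,\mathbf e_2,-\mathbf e_3\},\ \mathcal T_2=\{\mathbf e_3-\mathbf e_1,\mathbf e_2-\mathbf e_3,-\mathbf e_3\},$$ $$\mathcal T_3=\{\mathbf e_2-\mathbf e_1,\mathbf e_2-\mathbf e_3,-\mathbf e_2\},\ \mathcal T_4=\{\mathbf e_2-\mathbf e_1,\mathbf e_1-\mathbf e_3,-\mathbf e_1\},$$ $$\mathcal T_{12}=\{-\mathbf e_1,\mathbf e_2,\mathbf e_3\},\ \mathcal T_{13}=\{-\mathbf e_1,-\mathbf e_3,\mathbf e_2\},\ \mathcal T_{14}=\{\mathbf e_2,-\mathbf e_3,\mathbf e_1\},$$ $$\mathcal T_{23}=\{\mathbf e_3-\mathbf e_1,-\mathbf e_3,\mathbf e_2-\mathbf e_3\},\ \mathcal T_{24}=\{\mathbf e_2-\mathbf e_3,-\mathbf e_3,\mathbf e_1-\mathbf e_3\},\ \mathcal T_{34}=\{\mathbf e_2-\mathbf e_3,-\mathbf e_2,\mathbf e_1-\mathbf e_2\},$$ $$\mathcal T_{123}=\{-\mathbf e_1,\mathbf e_3,\mathbf e_2\},\ \mathcal T_{124}=\{\mathbf e_2,\mathbf e_3,\mathbf e_1\},\ \mathcal T_{134}=\{-\mathbf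 e_3,\mathbf e_2,\mathbf e_1\},$$ $$\mathcal T_{234}=\{-\mathbf e_3,\mathbf e_2-\mathbf e_3,\mathbf e_1-\mathbf e_3\},\ \mathcal T_{1234}=\{\mathbf e_3,\mathbf e_2,\mathbf e_1\}.$$ Then the tensor product of the basis with the template, $$\Big\{\bigoplus_{i=1}^4\mathcal V_i^p\otimes\mathcal T_i\Big\}\oplus\Big\{\bigoplus_{j\in\mathcal J}\mathcal E^p_j\otimes\mathcal T_j\Big\}\oplus\Big\{\bigoplus_{k\in\mathcal K}\mathcal F^p_k\otimes\mathcal T_k\Big\}\oplus\{\mathcal C^p_{1234}\otimes\mathcal T_{1234}\},$$ with $\mathcal J=\{(1,2),(1,3),(1,4),(2,3),(2,4),(3,4)\}$ and $\mathcal K=\{(1,2,3),(1,2,4),(1,3,4),(2,3,4)\}$, yields a unisolvent Brezzi-Douglas-Marini element $\mathcal{BDM}^p(\Omega)$.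
   Context: $\Omega=\{(\xi,\eta,\zeta)\in[0,1]^3\mid \xi+\eta+\zeta\le1\}$ has vertices $v_1=(0,0,0)$, $v_2=(0,0,1)$, $v_3=(0,1,0)$, $v_4=(1,0,0)$, edges $e_{ij}$ joining $v_i,v_j$, faces $f_{ijk}$ with vertices $v_i,v_j,v_k$, and cell $c_{1234}$ (its interior). $\mathbf e_1,\mathbf e_2,\mathbf e_3$ is the Cartesian basis. $P^p(\Omega)$ denotes the polynomials of total degree at most $p$. $H^1$-conforming polynomial basis $U^p(\Omega)$: linearly independent polynomials in $P^p(\Omega)$ with $\dim U^p(\Omega)=\dim P^p(\Omega)=(p+3)(p+2)(p+1)/6$, each associated with one polytope: one vertex base function per vertex ($\mathcal V^p_i$), $p-1$ edge base functions per edge ($\mathcal E^p_j$), $(p-2)(p-1)/2$ face base functions per face ($\mathcal F^p_k$), and $(p-3)(p-2)(p-1)/6$ cell base functions ($\mathcal C^p_{1234}$). A vertex base function vanishes at all other vertices and on non-neighbouring edges and faces; an edge base function vanishes on all other edges and non-neighbouring faces; a face base function vanishes on all other faces; a cell base function vanishes on the whole boundary. $\mathcal S\otimes\mathcal T_\ast$ denotes all products $n\,\boldsymbol\ell$ with $n\in\mathcal S$, $\boldsymbol\ell\in\mathcal T_\ast$. ''Unisolvent Brezzi-Douglas-Marini element'' means: the vectorial base functions so obtained are linearly independent and form a basis of the Brezzi-Douglas-Marini space, whose polynomial space on $\Omega$ is $[P^p(\Omega)]^3$. *)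

(* Defs.v *)
From mathcomp Require Import all_boot all_order all_algebra.
From mathcomp Require Import reals.
From mathcomp Require Import mpoly.

Set Implicit Arguments.
Unset Strict Implicit.
Unset Printing Implicit Defensive.

Import GRing.Theory Num.Theory.
Local Open Scope ring_scope.

Section LinearAlgebra.
Variables (R : nzRingType) (V : lmodType R).

Definition lin_indep (s : seq V) : Prop :=
  forall c : 'I_(size s) -> R,
    \sum_(i < size s) c i *: s`_i = 0 -> forall i, c i = 0.

Definition is_basis (S : V -> Prop) (s : seq V) : Prop :=
  [/\ forall v, v \in s -> S v,
      lin_indep s
    & forall v, S v ->
        exists c : 'I_(size s) -> R, v = \sum_(i < size s) c i *: s`_i].

End LinearAlgebra.

Inductive polytope :=
  | V1 | V2 | V3 | V4
  | E12 | E13 | E14 | E23 | E24 | E34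
  | F123 | F124 | F134 | F234
  | C1234.

Definition polytopes : seq polytope :=
  [:: V1; V2; V3; V4; E12; E13; E14; E23; E24; E34;
      F123; F124; F134; F234; C1234].

Definition verts (P : polytope) : seq nat :=
  match P with
  | V1 => [:: 1] | V2 => [:: 2] | V3 => [:: 3] | V4 => [:: 4]
  | E12 => [:: 1; 2] | E13 => [:: 1; 3] | E14 => [:: 1; 4]
  | E23 => [:: 2; 3] | E24 => [:: 2; 4] | E34 => [:: 3; 4]
  | F123 => [:: 1; 2; 3] | F124 => [:: 1; 2; 4]
  | F134 => [:: 1; 3; 4] | F234 => [:: 2; 3; 4]
  | C1234 => [:: 1; 2; 3; 4]
  end%N.

Definition is_vertex (P : polytope) : Prop := size (verts P) = 1%N.
Definition is_edge (P : polytope) : Prop := size (verts P) = 2%N.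
Definition is_face (P : polytope) : Prop := size (verts P) = 3%N.

(* [Q] is a neighbour of the lower-dimensional [P] when [P] lies on [Q]. *)
Definition neighbour (P Q : polytope) : Prop := {subset verts P <= verts Q}.

Section Tetrahedron.
Variable R : realType.

Definition e1 : 'rV[R]_3 := delta_mx 0 0.
Definition e2 : 'rV[R]_3 := delta_mx 0 1.
Definition e3 : 'rV[R]_3 := delta_mx 0 2.

(* The vertices of the unit tetrahedron, numbered from 1; the value at labels
   outside 1..4 is never used. *)
Definition vertex (i : nat) : 'rV[R]_3 :=
  match i with
  | 2 => e3
  | 3 => e2
  | 4 => e1
  | _ => 0%R
  end%N.

(* The closed polytope, as the convex hull of its vertices. *)
Definition points (P : polytope) (x : 'rV[R]_3) : Prop :=
  exists lam : nat -> R,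
    [/\ forall i, 0 <= lam i,
        \sum_(i <- verts P) lam i = 1
      & x = \sum_(i <- verts P) lam i *: vertex i].

Definition boundary (x : 'rV[R]_3) : Prop :=
  exists2 P, is_face P & points P x.

(* Polynomials on the tetrahedron are taken as formal polynomials in three
   variables: the tetrahedron has nonempty interior, so a polynomial function
   on it determines its coefficients. *)
Definition vanishes_on (n : {mpoly R[3]}) (A : 'rV[R]_3 -> Prop) : Prop :=
  forall x, A x -> n.@[x 0] = 0.

(* [msize] is one more than the total degree. *)
Definition Pspace (p : nat) (n : {mpoly R[3]}) : Prop := (msize n <= p.+1)%N.

Definition all_functions (U : polytope -> seq {mpoly R[3]}) :
    seq {mpoly R[3]} :=
  flatten [seq U P | P <- polytopes].

(* [U P] lists the base functions associated with the polytope [P]. For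
   [1 <= p] the truncated subtractions only differ from the integer ones in
   products that have a factor 0 in both cases. *)
Record H1_basis (p : nat) (U : polytope -> seq {mpoly R[3]}) : Prop := {
  H1_degree : forall P n, n \in U P -> Pspace p n;
  H1_indep : lin_indep (all_functions U);
  H1_dim : size (all_functions U) = ((p + 3) * (p + 2) * (p + 1) %/ 6)%N;
  H1_vertex_size : forall P, is_vertex P -> size (U P) = 1%N;
  H1_edge_size : forall P, is_edge P -> size (U P) = (p - 1)%N;
  H1_face_size : forall P, is_face P ->
    size (U P) = ((p - 2) * (p - 1) %/ 2)%N;
  H1_cell_size : size (U C1234) = ((p - 3) * (p - 2) * (p - 1) %/ 6)%N;
  H1_vertex_vertex : forall P Q n, n \in U P -> is_vertex P ->
    is_vertex Q -> Q <> P -> vanishes_on n (points Q);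
  H1_vertex_edge : forall P Q n, n \in U P -> is_vertex P ->
    is_edge Q -> ~ neighbour P Q -> vanishes_on n (points Q);
  H1_vertex_face : forall P Q n, n \in U P -> is_vertex P ->
    is_face Q -> ~ neighbour P Q -> vanishes_on n (points Q);
  H1_edge_edge : forall P Q n, n \in U P -> is_edge P ->
    is_edge Q -> Q <> P -> vanishes_on n (points Q);
  H1_edge_face : forall P Q n, n \in U P -> is_edge P ->
    is_face Q -> ~ neighbour P Q -> vanishes_on n (points Q);
  H1_face_face : forall P Q n, n \in U P -> is_face P ->
    is_face Q -> Q <> P -> vanishes_on n (points Q);
  H1_cell_boundary : forall n, n \in U C1234 -> vanishes_on n boundary
}.

Definition template (P : polytope) : seq 'rV[R]_3 :=
  match P with
  | V1 => [:: - e1; e2; - e3]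
  | V2 => [:: e3 - e1; e2 - e3; - e3]
  | V3 => [:: e2 - e1; e2 - e3; - e2]
  | V4 => [:: e2 - e1; e1 - e3; - e1]
  | E12 => [:: - e1; e2; e3]
  | E13 => [:: - e1; - e3; e2]
  | E14 => [:: e2; - e3; e1]
  | E23 => [:: e3 - e1; - e3; e2 - e3]
  | E24 => [:: e2 - e3; - e3; e1 - e3]
  | E34 => [:: e2 - e3; - e2; e1 - e2]
  | F123 => [:: - e1; e3; e2]
  | F124 => [:: e2; e3; e1]
  | F134 => [:: - e3; e2; e1]
  | F234 => [:: - e3; e2 - e3; e1 - e3]
  | C1234 => [:: e3; e2; e1]
  end.

(* Vectorial polynomials are finite functions rather than row vectors, whose
   scalars would be the polynomials instead of [R]. *)
Definition vpoly := {ffun 'I_3 -> {mpoly R[3]}}.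

Definition vmul (n : {mpoly R[3]}) (l : 'rV[R]_3) : vpoly :=
  [ffun k => l 0 k *: n].

Definition tensor (S : seq {mpoly R[3]}) (T : seq 'rV[R]_3) : seq vpoly :=
  [seq vmul n l | n <- S, l <- T].

Definition template_functions (U : polytope -> seq {mpoly R[3]}) :
    seq vpoly :=
  flatten [seq tensor (U P) (template P) | P <- polytopes].

Definition BDM_space (p : nat) (f : vpoly) : Prop :=
  forall k, Pspace p (f k).

Definition unisolvent_BDM (p : nat) (s : seq vpoly) : Prop :=
  is_basis (@BDM_space p) s.

End Tetrahedron.

(* Main.v *)
(* Each of the fifteen templates is a basis of R^3, that is, the rows of an
   invertible 3 x 3 matrix. Grouping a combination of the products n l by the
   scalar function n and reading off the k-th component gives a combination of
   the scalar functions, whose coefficients are the k-th entries of coefficient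
   rows multiplied by template matrices. Independence and spanning are thus
   inherited from the scalar family, which is a basis of P^p because it is
   independent and has dim P^p elements. *)
Require Import Defs.
From mathcomp Require Import all_boot all_order all_algebra.
From mathcomp Require Import reals.
From mathcomp Require Import mpoly.
From mathcomp Require Import lra.

Set Implicit Arguments.
Unset Strict Implicit.
Unset Printing Implicit Defensive.

Import GRing.Theory Num.Theory.
Local Open Scope ring_scope.

Section NatIndexed.
Variables (R : nzRingType) (V : lmodType R).

(** Coefficients indexed by [nat] allow index arithmetic such as [a * 3 + j] without bound proofs;
    outside the range they are 0. *)
Lemma ord_to_nat_coeff (s : seq V) (c : 'I_(size s) -> R) :
  exists c' : nat -> R, forall i : 'I_(size s), c' i = c i.
Proof. by exists (fun i => oapp c 0 (insub i)) => i; rewrite valK. Qed.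

Lemma lin_indep_natP (s : seq V) :
  lin_indep s <-> forall c : nat -> R,
    \sum_(0 <= i < size s) c i *: s`_i = 0 ->
    forall i, (i < size s)%N -> c i = 0.
Proof.
split=> indep_s c.
  rewrite big_mkord => c0 i i_lt.
  exact: (indep_s (fun i => c i) c0 (Ordinal i_lt)).
have [c' c'E] := ord_to_nat_coeff c => c0 i; rewrite -c'E.
apply: indep_s => //; rewrite big_mkord -[RHS]c0.
by apply: eq_bigr => j _; rewrite c'E.
Qed.

End NatIndexed.

Lemma nth_flatten_const (T : Type) (x0 : T) (k : nat) (ss : seq (seq T))
    (i j : nat) :
  all (fun r => size r == k) ss -> (i < size ss)%N -> (j < k)%N ->
  nth x0 (flatten ss) (i * k + j) = nth x0 (nth [::] ss i) j.
Proof.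
elim: ss i => [|r ss IHss] [|i] //= /andP[/eqP size_r size_ss] i_lt j_lt.
  by rewrite nth_cat size_r j_lt.
by rewrite nth_cat size_r mulSn -addnA ltnNge leq_addr addKn IHss.
Qed.

Lemma size_flatten_const (T : Type) (k : nat) (ss : seq (seq T)) :
  all (fun r => size r == k) ss -> size (flatten ss) = (size ss * k)%N.
Proof.
elim: ss => //= r ss IHss /andP[/eqP size_r size_ss].
by rewrite size_cat IHss // size_r mulSn.
Qed.

(* [flatten_mapP] does not apply to [polytope], which has no [eqType]. *)
Lemma mem_flatten_map (S : Type) (T : eqType) (f : S -> seq T) (s : seq S)
    (y : T) :
  y \in flatten [seq f x | x <- s] -> exists x, y \in f x.
Proof.
by elim: s => //= x s IHs; rewrite mem_cat => /orP[y_fx|/IHs //]; exists x.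
Qed.

Lemma big_nat_mul_add (V : nmodType) (n k : nat) (F : nat -> V) :
  \sum_(0 <= i < n * k) F i = \sum_(0 <= a < n) \sum_(j < k) F (a * k + j)%N.
Proof.
rewrite big_nat_mul; apply: eq_bigr => a _.
rewrite -{1}[(a * k)%N]add0n big_addn mulSn addnK big_mkord.
by apply: eq_bigr => j _; rewrite addnC.
Qed.

(** Exponent vectors of degree at most [p] correspond entrywise to the [n]-tuples over ['I_p.+1]
    with sum at most [p], whose number is known. *)
Lemma card_bmultinom (n p : nat) : #|{: 'X_{1..n < p.+1}}| = 'C(n + p, n).
Proof.
pose f (m : 'X_{1..n < p.+1}) : n.-tuple 'I_p.+1 :=
  [tuple inord (bmnm m i) | i < n].
have mi_lt (m : 'X_{1..n < p.+1}) i : (m i < p.+1)%N.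
  apply: leq_ltn_trans (bmdeg m).
  by rewrite mdegE (bigD1 i) //= leq_addr.
have f_inj : injective f.
  move=> m1 m2 eq_f; apply/val_inj/mnmP => i.
  have := congr1 (fun t => val (tnth t i)) eq_f.
  by rewrite !tnth_mktuple /= !inordK.
rewrite -card_partial_ord_partitions -(card_imset _ f_inj).
apply: eq_card => t; rewrite inE; apply/imsetP/idP => [[m _ ->]|t_le].
  rewrite big_tuple -ltnS; apply: leq_trans (bmdeg m); rewrite mdegE ltnS.
  by apply: leq_sum => i _; rewrite tnth_mktuple inordK.
have t_deg : (mdeg [multinom val (tnth t i) | i < n] < p.+1)%N.
  rewrite mdegE ltnS; apply: leq_trans t_le; rewrite big_tuple.
  by apply: leq_sum => i _; rewrite mnmE.
exists (BMultinom t_deg) => //; apply: eq_from_tnth => i.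
by rewrite tnth_mktuple /= mnmE; apply: val_inj; rewrite /= inordK.
Qed.

Section ScalarBasis.
Variables (R : fieldType) (n p : nat) (s : seq {mpoly R[n]}).
Hypothesis s_deg : forall q, q \in s -> (msize q <= p.+1)%N.

Lemma mpoly_bmultinomP (q1 q2 : {mpoly R[n]}) :
  (msize q1 <= p.+1)%N -> (msize q2 <= p.+1)%N ->
  (forall m : 'X_{1..n < p.+1}, q1@_m = q2@_m) -> q1 = q2.
Proof.
move=> deg1 deg2 eq_q; apply/mpolyP => m.
have [m_lt|m_ge] := ltnP (mdeg m) p.+1; first exact: (eq_q (BMultinom m_lt)).
by rewrite !memN_msupp_eq0 // msize_mdeg_ge // (leq_trans _ m_ge).
Qed.

Lemma msize_lin_comb (c : 'I_(size s) -> R) :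
  (msize (\sum_(i < size s) c i *: s`_i) <= p.+1)%N.
Proof.
apply: leq_trans (msize_sum _ _ _) _; apply/bigmax_leqP => i _.
exact: leq_trans (msizeZ_le _ _) (s_deg (mem_nth _ _)).
Qed.

(** The matrix of monomial coefficients of [s] has independent rows and, by the count of monomials,
    is square; so its rows span all coefficient vectors. *)
Lemma lin_indep_span :
  lin_indep s -> size s = 'C(n + p, n) ->
  forall q, (msize q <= p.+1)%N ->
    exists c : 'I_(size s) -> R, q = \sum_(i < size s) c i *: s`_i.
Proof.
move=> indep_s size_s q q_deg.
pose coeffs : 'M[R]_(size s, #|{: 'X_{1..n < p.+1}}|) :=
  \matrix_(i, m) (s`_i)@_(enum_val m : 'X_{1..n < p.+1}).
have coeffsE (v : 'rV_(size s)) m :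
    (v *m coeffs) 0 (enum_rank m) = (\sum_i v 0 i *: s`_i)@_m.
  rewrite mxE raddf_sum /=; apply: eq_bigr => i _.
  by rewrite mxE enum_rankK mcoeffZ.
have free_coeffs : row_free coeffs.
  apply: inj_row_free => v v0; apply/rowP => i; rewrite [RHS]mxE.
  apply: indep_s i; apply: mpoly_bmultinomP => [||m].
  - exact: msize_lin_comb.
  - by rewrite msize0.
  by rewrite -coeffsE v0 mxE mcoeff0.
(* The rank is [size s], which equals the number of columns. *)
have full_coeffs : row_full coeffs.
  by rewrite /row_full (eqP free_coeffs) size_s card_bmultinom.
have /submxP[v qE] := submx_full (\row_m q@_(enum_val m : 'X_{1..n < p.+1})) full_coeffs.
exists (v 0); apply: mpoly_bmultinomP => // [|m]; first exact: msize_lin_comb.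
by rewrite -coeffsE -qE mxE enum_rankK.
Qed.

End ScalarBasis.

Section Template.
Variable R : realType.
Implicit Types (P : polytope) (L : seq ({mpoly R[3]} * polytope)).

Definition template_mx P : 'M[R]_3 := \matrix_j (template R P)`_j.

Lemma size_template P : size (template R P) = 3%N.
Proof. by case: P. Qed.

Lemma template_mx_unit P : template_mx P \in unitmx.
Proof.
rewrite -row_free_unit; apply: inj_row_free => v v0.
have eq_v (k : 'I_3) : \sum_j v 0 j * (template R P)`_j 0 k = 0.
  move/rowP/(_ k): v0; rewrite [LHS]mxE [RHS]mxE => v0k; rewrite -[RHS]v0k.
  by apply: eq_bigr => j _; rewrite mxE.
have [v00 v01 v02] : [/\ v 0 0 = 0, v 0 1 = 0 & v 0 2 = 0].
  have := (eq_v 0, eq_v 1, eq_v 2); rewrite !big_ord_recl !big_ord0 /=.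
  (* The indices left by [big_ord_recl] are normalised so that [lra] sees the same atoms [v 0 0],
     [v 0 1], [v 0 2] in hypotheses and goal. *)
  have -> : lift ord0 ord0 = 1 :> 'I_3 by exact: val_inj.
  have -> : lift ord0 (lift ord0 ord0) = 2 :> 'I_3 by exact: val_inj.
  have -> : ord0 = 0 :> 'I_3 by exact: val_inj.
  by case: {v0 eq_v} P => /=; rewrite !mxE /= => -[[? ?] ?]; split; lra.
apply/rowP => j; rewrite mxE; case: j => [[|[|[|//]]] j_lt].
- by rewrite -[RHS]v00; congr (v 0 _); exact: val_inj.
- by rewrite -[RHS]v01; congr (v 0 _); exact: val_inj.
by rewrite -[RHS]v02; congr (v 0 _); exact: val_inj.
Qed.

(** Each scalar function carries the polytope that selects its template, so one flat list of blocks
    of length three treats all polytopes uniformly. *)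
Definition vector_family L : seq (vpoly R) :=
  flatten [seq [seq vmul x.1 l | l <- template R x.2] | x <- L].

Lemma all_size_vector_family L :
  all (fun r => size r == 3%N)
    [seq [seq vmul x.1 l | l <- template R x.2] | x <- L].
Proof. by elim: L => //= x L ->; rewrite size_map size_template. Qed.

Lemma size_vector_family L : size (vector_family L) = (size L * 3)%N.
Proof.
by rewrite (size_flatten_const (all_size_vector_family L)) size_map.
Qed.

(** Position [a * 3 + j] holds the [a]-th scalar function times the [j]-th vector of its template,
    so each block of three coefficients acts through one template matrix. *)
Lemma vector_family_lin_comb L (x0 := (0, C1234)) (c : nat -> R) (k : 'I_3) :
  (\sum_(0 <= i < size (vector_family L)) c i *: (vector_family L)`_i) k
  = \sum_(0 <= a < size L)
      (\row_(j < 3) c (a * 3 + j)%N *m template_mx (nth x0 L a).2) 0 k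
        *: [seq x.1 | x <- L]`_a.
Proof.
rewrite size_vector_family big_nat_mul_add sum_ffunE.
apply: eq_big_nat => a /andP[_ a_lt]; rewrite sum_ffunE mxE scaler_suml.
apply: eq_bigr => j _; rewrite nth_flatten_const ?all_size_vector_family //;
  last by rewrite size_map.
rewrite (nth_map x0) // (nth_map 0) ?size_template //.
by rewrite (nth_map x0) // !mxE !ffunE scalerA.
Qed.

Lemma vector_family_lin_indep L :
  lin_indep [seq x.1 | x <- L] -> lin_indep (vector_family L).
Proof.
move=> /lin_indep_natP indep; apply/lin_indep_natP => c c0 i.
rewrite size_vector_family => i_lt.
have a_lt : (i %/ 3 < size L)%N by rewrite ltn_divLR.
set a := (i %/ 3)%N in a_lt *.
pose row_c := \row_(j < 3) c (a * 3 + j)%N.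
suff row_c0 : row_c = 0.
  have /rowP/(_ (Ordinal (ltn_pmod i (isT : 0 < 3)%N))) := row_c0.
  by rewrite !mxE /= -divn_eq.
(* As the template matrix is invertible, it is enough that the transformed block vanishes; its
   [k]-th entry is a coefficient in a vanishing combination of the scalar functions. *)
apply: (row_free_inj (A := template_mx (nth (0, C1234) L a).2)).
  by rewrite row_free_unit template_mx_unit.
rewrite mul0mx; apply/rowP => k; rewrite [RHS]mxE.
have := vector_family_lin_comb L c k; rewrite c0 ffunE => /esym comb0.
rewrite size_map in indep.
exact: (indep (fun a => (\row_(j < 3) c (a * 3 + j)%N
                           *m template_mx (nth (0, C1234) L a).2) 0 k)).
Qed.

Lemma vector_family_span L (f : vpoly R) (t := [seq x.1 | x <- L]) :
  (forall k, exists d : 'I_(size t) -> R, f k = \sum_(a < size t) d a *: t`_a) ->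
  exists c : 'I_(size (vector_family L)) -> R,
    f = \sum_(i < size (vector_family L)) c i *: (vector_family L)`_i.
Proof.
move=> span_t.
(* Finite choice fixes scalar coefficients for all three components at once. *)
have {span_t} /fin_all_exists[d fE] k :
    exists d : nat -> R, f k = \sum_(0 <= a < size L) d a *: t`_a.
  have [d ->] := span_t k; have [d' d'E] := ord_to_nat_coeff d; exists d'.
  by rewrite -[size L](size_map fst) big_mkord; apply: eq_bigr => a _; rewrite d'E.
(* For each scalar function, the row of its coefficients in the three components is expressed in the
   template basis by the inverse matrix. *)
pose c i := (\row_k d k (i %/ 3)%N
   *m invmx (template_mx (nth (0, C1234) L (i %/ 3)).2)) 0 (inord (i %% 3)).
exists c; apply/ffunP => k; rewrite -(big_mkord xpredT (fun i => c i *: _`_i)).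
rewrite vector_family_lin_comb fE; apply: eq_bigr => a _; congr (_ *: _).
set M := template_mx _.
have -> : \row_(j < 3) c (a * 3 + j)%N = \row_k d k a *m invmx M.
  apply/rowP => j; rewrite mxE /c divnMDl // modnMDl divn_small // modn_small //.
  by rewrite addn0 inord_val.
by rewrite mulmxKV ?template_mx_unit // mxE.
Qed.

Definition labelled_functions (U : polytope -> seq {mpoly R[3]}) :=
  flatten [seq [seq (n, P) | n <- U P] | P <- polytopes].

Lemma labelled_functions_fst (U : polytope -> seq {mpoly R[3]}) :
  [seq x.1 | x <- labelled_functions U] = all_functions U.
Proof.
rewrite map_flatten -map_comp; congr flatten.
by apply: eq_map => P /=; rewrite -map_comp map_id.
Qed.

Lemma template_functionsE (U : polytope -> seq {mpoly R[3]}) :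
  template_functions U = vector_family (labelled_functions U).
Proof.
rewrite /template_functions /vector_family /labelled_functions.
elim: polytopes => //= P Ps ->; rewrite map_cat flatten_cat; congr (_ ++ _).
by rewrite /tensor -map_comp.
Qed.

End Template.

Theorem theorem4p3 (R : realType) (p : nat)
    (U : polytope -> seq {mpoly R[3]}) :
  (1 <= p)%N -> H1_basis p U -> unisolvent_BDM p (template_functions U).
Proof.
move=> _ U_basis.
have U_deg n : n \in all_functions U -> (msize n <= p.+1)%N.
  by case/mem_flatten_map => P; exact: (H1_degree U_basis).
split.
- move=> v /mem_flatten_map[P /allpairsP[[n l] /= [nU _ ->]]] k.
  rewrite ffunE; apply: leq_trans (msizeZ_le _ _) _.
  exact: (H1_degree U_basis nU).
- rewrite template_functionsE; apply: vector_family_lin_indep.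
  by rewrite labelled_functions_fst; exact: (H1_indep U_basis).
move=> f f_deg; rewrite template_functionsE; apply: vector_family_span.
rewrite labelled_functions_fst => k.
apply: (lin_indep_span U_deg (H1_indep U_basis)) (f_deg k).
(* It remains to identify ['C(3 + p, 3)] with the prescribed dimension, by writing it as a falling
   factorial divided by [3!]. *)
rewrite (H1_dim U_basis) bin_ffactd [(3 + p)%N]addnC addn3 addn2 addn1.
by rewrite !ffactnS ffactn0 muln1 mulnA.
Qed.
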